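(* Let $u\in\mathbb{K}$ be the minimizer of $J(v)=\frac12\int_\Omega|\nabla v|^2\,dx$ over $\mathbb{K}$. Then for every $v\in\mathbb{K}$, every $\lambda\in\Lambda$ and every $y^*\in Q^*_{\lambda,\mathcal{M}}$, $$\|\nabla(v-u)\|_\Omega^2\le \|\nabla v-y^*\|_\Omega^2+2\int_{\mathcal{M}}\lambda\,(v-\psi)\,d\mu .$$
   Context: $\Omega\subset\mathbb{R}^n$ is open, connected and bounded with Lipschitz continuous boundary $\partial\Omega$; $\mathcal{M}$ is a smooth $(n-1)$-dimensional manifold in $\mathbb{R}^n$ which divides $\Omega$ into two Lipschitz subdomains $\Omega_+$ and $\Omega_-$. Integrals over $\mathcal{M}$ (with surface measure $d\mu$) and the space $L^2(\mathcal{M})$ refer to the part of $\mathcal{M}$ in $\Omega$; values of Sobolev functions on $\mathcal{M}$ and $\partial\Omega$ are traces. $\|\cdot\|_\omega$ denotes the $L^2(\omega)$ norm of scalar or vector-valued functions. The obstacle $\psi:\mathcal{M}\to\mathbb{R}$ is smooth, the boundary datum is $\varphi\in H^{1/2}(\partial\Omega)$, and $\varphi\ge\psi$ on $\mathcal{M}\cap\partial\Omega$. Admissible set: $\mathbb{K}=\{v\in H^1(\Omega): v\ge\psi\text{ on }\mathcal{M}\cap\Omega,\ v=\varphi\text{ on }\partial\Omega\}$, a closed convex set; it is known that $J$ has a unique minimizer $u$ over $\mathbb{K}$ (the thin obstacle problem). $\Lambda=\{\lambda\in L^2(\mathcal{M}):\lambda\ge0\text{ a.e. on }\mathcal{M}\}$,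 and for $\lambda\in\Lambda$ $$Q^*_{\lambda,\mathcal{M}}=\Big\{y^*\in L^2(\Omega,\mathbb{R}^n):\int_\Omega y^*\cdot\nabla w\,dx=\int_{\mathcal{M}}\lambda w\,d\mu\ \ \forall w\in H^1_0(\Omega)\Big\}.$$ *)

(* Defs.v *)
From HB Require Import structures.
From mathcomp Require Import all_boot all_order all_algebra.
From mathcomp Require Import all_classical all_reals all_analysis.

Set Implicit Arguments.
Unset Strict Implicit.
Unset Printing Implicit Defensive.

Import Order.TTheory GRing.Theory Num.Theory.
Import numFieldTopology.Exports numFieldNormedType.Exports.

Local Open Scope classical_set_scope.
Local Open Scope ring_scope.

(* R^n is 'rV[R]_n.  The library norm on 'rV[R]_n is the sup norm; it is used
   only through the topology, boundedness and Lipschitz continuity, which do not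
   depend on the choice of the norm. *)
Section euclidean.
Context {R : realType} {n : nat}.
Implicit Types x y : 'rV[R]_n.

Definition dot x y : R := \sum_(i < n) x 0 i * y 0 i.

Definition enorm x : R := Num.sqrt (dot x x).

Definition ediam (A : set 'rV[R]_n) : \bar R :=
  ereal_sup [set (enorm (p.1 - p.2))%:E | p in A `*` A].

End euclidean.

(* T with every subset measurable: covers by arbitrary sets are then covers in
   the sense of mu_ext. *)
Definition all_measurable (T : Type) : Type := T.

HB.instance Definition _ (T : pointedType) :=
  Pointed.on (all_measurable T).
HB.instance Definition _ (T : pointedType) :=
  @isMeasurable.Build default_measure_display (all_measurable T)
    discrete_measurable discrete_measurable0 discrete_measurableC
    discrete_measurableU.

Definition cara_measure (R : realType) (T : pointedType)
    (mu : {outer_measure set T -> \bar R}) :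
    {measure set (caratheodory_type mu) -> \bar R} :=
  [the measure (caratheodory_type mu) R of
     (mu : set (caratheodory_type mu) -> \bar R)].

Section lebesgue_outer_measure.
Context (R : realType) (m : nat).
Local Open Scope ereal_scope.

(* The volume of a half-open box, and +oo on sets that are not boxes; the empty
   set is a (degenerate) box because the dimension is positive. *)
Definition box_volume (A : set (all_measurable 'rV[R]_m.+1)) : \bar R :=
  ereal_inf [set (\prod_(i < m.+1) (p.2 0 i - p.1 0 i))%R%:E
            | p in [set p : 'rV[R]_m.+1 * 'rV[R]_m.+1 |
                (forall i, (p.1 0 i <= p.2 0 i)%R) /\
                A = [set x : 'rV[R]_m.+1 |
                      forall i, (p.1 0 i < x 0 i <= p.2 0 i)%R]]].

Definition lebesgue_outer (A : set 'rV[R]_m.+1) : \bar R :=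
  mu_ext box_volume A.

Lemma box_volume_ge0 A : 0 <= box_volume A.
Proof.
apply: le_ereal_inf_tmp => _ [[a b] /= [ab _] <-].
by rewrite lee_fin; apply: prodr_ge0 => i _; rewrite subr_ge0.
Qed.

Lemma box_volume0 : box_volume set0 = 0.
Proof.
apply/eqP; rewrite eq_le box_volume_ge0 andbT.
apply: ereal_inf_lbound; exists (0%R : 'rV[R]_m.+1, 0%R : 'rV[R]_m.+1); last first.
  by rewrite /= (bigD1 ord0)//= subrr mul0r.
split=> //=; apply/esym; rewrite -subset0 => x /= /(_ ord0).
by move=> /andP[x0 /(lt_le_trans x0)]; rewrite ltxx.
Qed.

HB.instance Definition _ := isOuterMeasure.Build R 'rV[R]_m.+1 lebesgue_outer
  (mu_ext0 box_volume0 box_volume_ge0) (mu_ext_ge0 box_volume_ge0)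
  (@le_mu_ext _ _ _ box_volume) (mu_ext_sigma_subadditive box_volume_ge0).

Definition leb := cara_measure lebesgue_outer.

End lebesgue_outer_measure.

(* Volume of the unit ball of R^k, by the recursion
   omega_0 = 1, omega_1 = 2, omega_(k+2) = 2 pi / (k + 2) * omega_k. *)
Fixpoint unit_ball_volume (R : realType) (k : nat) : R :=
  match k with
  | 0%N => 1
  | 1%N => 2
  | j.+2 => 2 * pi / j.+2%:R * unit_ball_volume R j
  end.

Section hausdorff_outer_measure.
Context (R : realType) (n k : nat).
Local Open Scope ereal_scope.

Definition hausdorff_weight (delta : R) (A : set (all_measurable 'rV[R]_n))
    : \bar R :=
  if pselect (A = set0) then 0
  else if ediam A <= delta%:E
  then (unit_ball_volume R k * (fine (ediam A) / 2) ^+ k)%R%:E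
  else +oo.

(* The k-dimensional Hausdorff measure on R^n, normalized so that it is the
   usual k-dimensional area (the counting measure for k = 0). *)
Definition hausdorff_outer (A : set 'rV[R]_n) : \bar R :=
  ereal_sup [set mu_ext (hausdorff_weight delta) A
            | delta in [set delta : R | (0 < delta)%R]].

Lemma unit_ball_volume_ge0 (j : nat) : (0 <= unit_ball_volume R j)%R.
Proof.
suff: (0 <= unit_ball_volume R j /\ 0 <= unit_ball_volume R j.+1)%R by case.
elim: j => [|j [IH0 IH1]] //; split=> //.
by rewrite /= mulr_ge0// divr_ge0// mulr_ge0// pi_ge0.
Qed.

Lemma ediam_ge0 (A : set 'rV[R]_n) : A <> set0 -> 0 <= ediam A.
Proof.
move=> /eqP/set0P[x Ax]; apply: (@le_trans _ _ (enorm (x - x))%:E).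
  by rewrite lee_fin sqrtr_ge0.
by apply: ereal_sup_ubound; exists (x, x).
Qed.

Lemma hausdorff_weight_ge0 delta A : 0 <= hausdorff_weight delta A.
Proof.
rewrite /hausdorff_weight; case: pselect => //= A0.
case: ifPn => // _; rewrite lee_fin mulr_ge0 ?unit_ball_volume_ge0//.
by rewrite exprn_ge0// divr_ge0// fine_ge0// ediam_ge0.
Qed.

Lemma hausdorff_weight0 delta : hausdorff_weight delta set0 = 0.
Proof. by rewrite /hausdorff_weight; case: pselect. Qed.

Let pre delta (A : set 'rV[R]_n) := mu_ext (hausdorff_weight delta) A.

Lemma hausdorff_outer0 : hausdorff_outer set0 = 0.
Proof.
rewrite /hausdorff_outer -[RHS]ereal_sup1; congr ereal_sup.
apply/seteqP; split=> [_ [d _ <-]|_ ->] /=.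
  exact: mu_ext0 (hausdorff_weight0 d) (hausdorff_weight_ge0 d).
exists 1%R => //=.
exact: mu_ext0 (hausdorff_weight0 _) (hausdorff_weight_ge0 _).
Qed.

Lemma hausdorff_outer_ge0 A : 0 <= hausdorff_outer A.
Proof.
apply: (@le_trans _ _ (pre 1%R A)).
  exact: mu_ext_ge0 (hausdorff_weight_ge0 _) _.
by apply: ereal_sup_ubound; exists 1%R => //=.
Qed.

Lemma le_hausdorff_outer :
  {homo hausdorff_outer : A B / A `<=` B >-> A <= B}.
Proof.
move=> A B AB; apply: ge_ereal_sup => _ [d d0 <-].
apply: (@le_trans _ _ (pre d B)); first exact: le_mu_ext.
by apply: ereal_sup_ubound; exists d.
Qed.

Lemma hausdorff_outer_sigma_subadditive : sigma_subadditive hausdorff_outer.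
Proof.
move=> F; apply: ge_ereal_sup => _ [d d0 <-].
apply: le_trans (mu_ext_sigma_subadditive (hausdorff_weight_ge0 d) F) _.
apply: lee_nneseries => i _.
  by move=> *; exact: mu_ext_ge0 (hausdorff_weight_ge0 _) _.
by apply: ereal_sup_ubound; exists d.
Qed.

HB.instance Definition _ := isOuterMeasure.Build R 'rV[R]_n hausdorff_outer
  hausdorff_outer0 hausdorff_outer_ge0 le_hausdorff_outer
  hausdorff_outer_sigma_subadditive.

Definition hausdorff := cara_measure hausdorff_outer.

End hausdorff_outer_measure.

Section smooth.
Context {R : realType} {n : nat}.
Implicit Types (f : 'rV[R]_n -> R) (U : set 'rV[R]_n).

Definition partial (i : 'I_n) f : 'rV[R]_n -> R := 'D_(delta_mx 0 i) f.

Definition gradient f (x : 'rV[R]_n) : 'rV[R]_n := \row_i partial i f x.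

(* C^infinity on an open set: all iterated partial derivatives exist and are
   continuous. *)
Definition smooth_on U f : Prop :=
  forall (s : seq 'I_n) x, U x ->
    {for x, continuous (foldr partial f s)} /\
    forall i, derivable (foldr partial f s) x (delta_mx 0 i).

Definition test_function U f : Prop :=
  [/\ smooth_on setT f, compact (closure [set x | f x != 0]) &
      closure [set x | f x != 0] `<=` U].

(* Smooth embedded (n-1)-dimensional submanifold of R^n: locally the zero set of
   a smooth function with nonvanishing gradient. *)
Definition smooth_hypersurface (M : set 'rV[R]_n) : Prop :=
  forall p, M p -> exists (U : set 'rV[R]_n) (F : 'rV[R]_n -> R),
    [/\ open U, U p, smooth_on U F, gradient F p != 0 &
        M `&` U = [set x | U x /\ F x = 0]].

(* Only the values of f on M matter. *)
Definition smooth_on_manifold (M : set 'rV[R]_n) f : Prop :=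
  forall p, M p -> exists (U : set 'rV[R]_n) (F : 'rV[R]_n -> R),
    [/\ open U, U p, smooth_on U F & {in M `&` U, f =1 F}].

End smooth.

Section domains.
Context {R : realType} {m : nat}.
Let E := 'rV[R]_m.+1.
Implicit Types Omega D M : set E.

Definition boundary D : set E := closure D `\` interior D.

(* Near each boundary point, in suitable Cartesian coordinates (the rows y *m Q
   with Q orthogonal), D lies strictly above the graph of a Lipschitz function
   of the last n - 1 coordinates. *)
Definition lipschitz_boundary D : Prop :=
  forall x, boundary D x ->
    exists (Q : 'M[R]_m.+1) (gamma : 'rV[R]_m -> R),
      [/\ Q *m Q^T = 1%:M, lipschitz gamma &
        \forall y \near x, D y <-> gamma (col' ord0 (y *m Q)) < (y *m Q) 0 0].

Definition lipschitz_domain D : Prop :=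
  [/\ D !=set0, open D, connected D & lipschitz_boundary D].

Definition divides M Omega : Prop :=
  exists Dp Dm, [/\ lipschitz_domain Dp, lipschitz_domain Dm,
    Dp `&` Dm = set0 & Omega `\` M = Dp `|` Dm].

End domains.

Section sobolev.
Context {R : realType} {m : nat}.
Let E := 'rV[R]_m.+1.
Implicit Types (Omega S M : set E) (f g phi psi lam : E -> R) (G y : E -> E).

Local Notation Leb := (lebesgue_outer (R := R) (m := m)).
Local Notation Surf := (hausdorff_outer (R := R) (n := m.+1) m).
Local Notation dx := (leb R m).
Local Notation dmu := (hausdorff R m.+1 m).

Definition L2 (mu : {outer_measure set E -> \bar R}) (D : set E) f : Prop :=
  measurable_fun (D : set (caratheodory_type mu)) f /\
  (\int[cara_measure mu]_(x in D) (f x ^+ 2)%:E < +oo)%E.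

Definition L2vec Omega G : Prop := forall i, L2 Leb Omega (fun x => G x 0 i).

Definition sqnorm Omega G : \bar R :=
  (\int[dx]_(x in Omega) (enorm (G x) ^+ 2)%:E)%E.

Definition weak_gradient Omega f G : Prop :=
  forall (zeta : E -> R) i, test_function Omega zeta ->
    (\int[dx]_(x in Omega) (f x * partial i zeta x)%:E =
     - \int[dx]_(x in Omega) (G x 0 i * zeta x)%:E)%E.

(* An element of H^1(Omega) is a representative of the function together with a
   representative of its weak gradient, which the function determines a.e. in
   Omega.  Values outside Omega are irrelevant. *)
Record H1 Omega : Type := MkH1 {
  H1_fun :> E -> R;
  grad : E -> E;
  H1_L2 : L2 Leb Omega H1_fun;
  grad_L2 : L2vec Omega grad;
  H1_weak_gradient : weak_gradient Omega H1_fun grad }.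

(* g is the trace of w on S, i.e. the value at w of the continuous extension to
   H^1(Omega) of the restriction map f |-> f|_S from smooth functions to L^2(S).
   By the trace theorem, g exists and is unique a.e. on S when S is the boundary
   of the Lipschitz domain Omega or the part in Omega of a hypersurface that
   divides it. *)
Definition is_trace Omega S (w : H1 Omega) g : Prop :=
  L2 Surf S g /\
  exists f_ : nat -> E -> R,
    [/\ forall k, smooth_on setT (f_ k),
        (\int[dx]_(x in Omega) ((f_ k x - w x) ^+ 2)%:E @[k --> \oo] --> 0)%E,
        (sqnorm Omega (fun x => (gradient (f_ k) x - grad w x)%R)
           @[k --> \oo] --> 0)%E &
        (\int[dmu]_(x in S) ((f_ k x - g x) ^+ 2)%:E @[k --> \oo] --> 0)%E].

(* H^(1/2) of the boundary, with the Sobolev-Slobodeckij seminorm; the exponent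
   of the distance is (n - 1) + 2 * (1/2) = n. *)
Definition Hhalf Omega phi : Prop :=
  L2 Surf (boundary Omega) phi /\
  (\int[dmu]_(x in boundary Omega) \int[dmu]_(y in boundary Omega)
     ((phi x - phi y) ^+ 2 / enorm (x - y) ^+ m.+1)%:E < +oo)%E.

Definition H10 Omega : set (H1 Omega) :=
  [set w | is_trace (boundary Omega) w (cst 0)].

Definition admissible Omega M psi phi : set (H1 Omega) :=
  [set v | (exists2 g, is_trace (M `&` Omega) v g &
              \forall x \ae dmu, (M `&` Omega) x -> psi x <= g x) /\
           is_trace (boundary Omega) v phi].

Definition J Omega (v : H1 Omega) : \bar R := (2^-1%:E * sqnorm Omega (grad v))%E.

Definition minimizer Omega (K : set (H1 Omega)) (u : H1 Omega) : Prop :=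
  K u /\ forall v, K v -> (J u <= J v)%E.

Definition Lambda Omega M : set (E -> R) :=
  [set lam | L2 Surf (M `&` Omega) lam /\
             \forall x \ae dmu, (M `&` Omega) x -> 0 <= lam x].

Definition Qstar Omega M lam : set (E -> E) :=
  [set y | L2vec Omega y /\
     forall (w : H1 Omega) g, H10 w -> is_trace (M `&` Omega) w g ->
       (\int[dx]_(x in Omega) (dot (y x) (grad w x))%:E =
        \int[dmu]_(x in M `&` Omega) (lam x * g x)%:E)%E].

End sobolev.

(* Main.v *)
Require Import Defs.
From mathcomp Require Import all_boot all_order all_algebra.
From mathcomp Require Import all_classical all_reals all_analysis.
From mathcomp Require Import measurable_realfun.
From mathcomp Require Import ring lra.

(** The minimizer [u] over a convex set satisfies the variational inequality
[<grad u, grad (v - u)> >= 0] for admissible [v], in the inner product of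
L^2(Omega).  Write [d = grad v - grad u].  Expanding the square,
[|grad v - y|^2 = |d|^2 + 2 <d, grad u - y> + |grad u - y|^2], hence
[|grad v - y|^2 + 2 <y, d> = |d|^2 + 2 <grad u, d> + |grad u - y|^2 >= |d|^2].
Since [v - u] vanishes on the boundary of [Omega], the equilibrium condition
on [y] turns [<y, d>] into the integral of [lam * (vM - uM)] over the
interface, and this is at most the integral of [lam * (vM - psi)], because
[lam >= 0] and [uM >= psi] almost everywhere.  Here [uM] is the trace that
admissibility of [u] provides, and [vM - uM] is a trace of [v - u].

What this argument takes for granted is linearity: admissible functions form a
convex set, [v - u] is an element of H^1 whose traces are the differences of
the traces, and integrals of products of L^2 functions are bilinear
([H1_lin], [is_trace_lin], [admissible_segment]).  The integral is additive
only on measurable functions, and measurability here is Caratheodory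
measurability for outer measures given by coverings, so the basis of
everything is that continuous functions are measurable both for Lebesgue and
for Hausdorff measure.  It suffices to treat the half-spaces
[{x | x_i <= c}], as open sets are countable unions of boxes
([measurable_open]).  For Lebesgue measure a half-space cuts a box into two
boxes whose volumes add up ([lebesgue_outer_halfspace]); for Hausdorff measure
the Caratheodory criterion applies, since the outer measure is additive on
sets separated by a slab ([caratheodory_sublevel], [hausdorff_gap]). *)

Set Implicit Arguments.
Unset Strict Implicit.
Unset Printing Implicit Defensive.

Import Order.TTheory GRing.Theory Num.Theory.
Import numFieldTopology.Exports numFieldNormedType.Exports.

Local Open Scope classical_set_scope.
Local Open Scope ring_scope.

(** * Outer measures given by coverings *)

Section covering.
Context (R : realType) (T : pointedType).
Local Open Scope ereal_scope.

(** Cutting every set of a covering of [A `|` B] along [P] and [Q] yields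
coverings of [A] and of [B] whose total weight is not larger.  Both outer
measures below are treated with it: boxes cut by a half-space, and sets too
small to meet both [P] and [Q]. *)
Lemma mu_extD_le (w : set (all_measurable T) -> \bar R) (P Q A B : set T) :
  (forall S, 0 <= w S) -> (forall S, w (S `&` P) + w (S `&` Q) <= w S) ->
  A `<=` P -> B `<=` Q -> mu_ext w A + mu_ext w B <= mu_ext w (A `|` B).
Proof.
move=> w0 wPQ AP BQ; apply: le_ereal_inf_tmp => _ [F [_ cF] <-].
apply: (@le_trans _ _ (\sum_(k <oo) (w (F k `&` P) + w (F k `&` Q)))); last first.
  by apply: lee_nneseries => // k _ *; rewrite adde_ge0.
rewrite nneseriesD//; apply: leeD; apply: ereal_inf_lbound.
- exists (fun k => F k `&` P) => //; split=> // x Ax.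
  by have [k _ Fk] := cF x (or_introl Ax); exists k => //; split=> //; exact: AP.
- exists (fun k => F k `&` Q) => //; split=> // x Bx.
  by have [k _ Fk] := cF x (or_intror Bx); exists k => //; split=> //; exact: BQ.
Qed.

Variables (mu : {outer_measure set T -> \bar R}) (p : T -> R).
Hypothesis mu_gap : forall (a b : R) (A B : set T), (a < b)%R ->
  A `<=` [set x | p x <= a]%R -> B `<=` [set x | b <= p x]%R ->
  mu A + mu B <= mu (A `|` B).

(** The Caratheodory criterion for one function: additivity across gaps in the
values of [p] makes the sublevel sets of [p] measurable.  The part of [A] above
[c] is exhausted by the sets [far k] that lie above [s k], and each [far k] is
separated from the sublevel set, so it remains to see that what is lost,
[A `&` {c < p <= s n}], has small measure.  It is covered by the layers
[layer k], [k >= n], whose measures form a convergent series because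
[layer k.+1] is separated from [far k]. *)
Lemma caratheodory_sublevel c : mu.-caratheodory [set x | (p x <= c)%R].
Proof.
apply: le_caratheodory_measurable => A.
have [->|Afin] := eqVneq (mu A) +oo; first by rewrite leey.
have {}Afin : mu A \is a fin_num.
  by rewrite ge0_fin_numE ?outer_measure_ge0// ltey.
pose s k : R := (c + k.+1%:R^-1)%R.
have s_gt k : (c < s k)%R by rewrite /s ltrDl invr_gt0 ltr0n.
have s_lt k : (s k.+1 < s k)%R.
  by rewrite /s ltrD2l ltf_pV2 ?posrE ?ltr0n// ltr_nat.
pose far k := A `&` [set x | (s k < p x)%R].
pose layer k := A `&` [set x | (s k.+1 < p x <= s k)%R].
have farA k : mu (far k) <= mu A by apply: le_outer_measure => x [].
have layer_far k : mu (far k) + mu (layer k.+1) <= mu (far k.+2).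
  rewrite addeC; apply: (@le_trans _ _ (mu (layer k.+1 `|` far k))).
    apply: (mu_gap (s_lt k)) => x [_] /=; first by case/andP.
    exact: ltW.
  apply: le_outer_measure => x [] [Ax /=] => [/andP[? _]|sx]; split=> //=.
  exact: lt_trans (s_lt _) (lt_trans (s_lt _) sx).
(* [layer k] touches [far k] and is separated only from the [far] set of the
   preceding index, so the bound involves two consecutive [far] sets *)
have sum_layer n : \sum_(0 <= k < n.+1) mu (layer k) <= mu (far n) + mu (far n.+1).
  elim: n => [|n IH].
    rewrite big_nat1 -[leLHS]add0e; apply: leeD; first exact: outer_measure_ge0.
    by apply: le_outer_measure => x [Ax /= /andP[]].
  rewrite big_nat_recr//=; apply: le_trans (leeD2r _ IH) _.
  by rewrite -addeA addeC -addeA leeD2l// addeC.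
have summable : \sum_(0 <= k <oo) mu (layer k) < +oo.
  apply: (@le_lt_trans _ _ (mu A + mu A)).
    apply: lime_le; first by apply: is_cvg_nneseries => *; exact: outer_measure_ge0.
    apply: nearW => -[|n]; first by rewrite big_geq// adde_ge0// outer_measure_ge0.
    by apply: le_trans (sum_layer n) _; exact: leeD.
  by rewrite lte_add_pinfty// ltey_eq Afin.
have tail0 := nneseries_tail_cvg summable (fun k _ => outer_measure_ge0 mu (layer k)).
have bound n : mu (A `&` [set x | (p x <= c)%R]) +
    mu (A `&` ~` [set x | (p x <= c)%R]) <= mu A + \sum_(n <= k <oo) mu (layer k).
  apply: (@le_trans _ _ (mu (A `&` [set x | (p x <= c)%R]) + mu (far n) +
      \sum_(n <= k <oo) mu (layer k))); last first.
    apply: leeD2r.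
    apply: (@le_trans _ _ (mu (A `&` [set x | (p x <= c)%R] `|` far n))); last first.
      by apply: le_outer_measure => x [] [].
    by apply: (mu_gap (s_gt n)) => x [_] //= /ltW.
  rewrite -addeA leeD2l//.
  apply: (@le_trans _ _ (mu (far n `|` \bigcup_(k in ~` `I_n) layer k))).
    apply: le_outer_measure => x [Ax /= /negP]; rewrite -ltNge => cx.
    have [snx|xsn] := ltP (s n) (p x); first by left.
    right; have [j sj] : exists j, (s (n + j).+1 < p x)%R.
      have [j jx] : exists j, ((p x - c)^-1 < j%:R)%R.
        by exists (Num.truncn (p x - c)^-1).+1; rewrite truncnS_gt.
      exists j; rewrite /s -ltrBrDl invf_plt ?posrE ?subr_gt0 ?ltr0n//.
      apply: lt_le_trans jx _; rewrite ler_nat; apply: leq_trans (leq_addl n j) _.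
      exact: leq_trans (leqnSn _) (leqnSn _).
    elim: j sj => [|j IH] sj.
      by exists n; rewrite /= ?ltnn// /layer /=; split=> //=; rewrite -{1}(addn0 n) sj.
    have [/IH//|xs] := ltP (s (n + j).+1) (p x).
    exists (n + j.+1)%N; first by apply/negP; rewrite -leqNgt leq_addr.
    by split=> //=; rewrite sj addnS.
  apply: le_trans (outer_measureU2 mu _ _) _.
  by rewrite leeD2l// outer_measure_sigma_subadditive_tail.
have lim : mu A + \sum_(n <= k <oo) mu (layer k) @[n --> \oo] --> mu A.
  rewrite -[X in _ --> X]adde0; apply: cvgeD tail0; last exact: cvg_cst.
  by rewrite fin_num_adde_defl.
by rewrite -(cvg_lim _ lim)//; apply: lime_ge; [apply/cvg_ex; eexists; exact: lim|exact: nearW].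
Qed.

End covering.

(** * Half-spaces are measurable *)

Section box_measure.
Context (R : realType) (m : nat).
Local Open Scope ereal_scope.

(** The new face of the two halves of the box is at [t], the number [c]
clipped to the edge of the box; if [c] is off the edge, one half is empty. *)
Lemma box_volume_cut (i : 'I_m.+1) (c : R) (S : set 'rV[R]_m.+1) :
  box_volume (S `&` [set x | (x 0 i <= c)%R]) +
  box_volume (S `&` ~` [set x | (x 0 i <= c)%R]) <= box_volume S.
Proof.
apply: le_ereal_inf_tmp => _ [[a b] /= [ab ->] <-].
pose t := Num.max (a 0 i)%R (Num.min (b 0 i)%R c).
pose b' : 'rV[R]_m.+1 := (\row_j if j == i then t else b 0 j)%R.
pose a' : 'rV[R]_m.+1 := (\row_j if j == i then t else a 0 j)%R.
have at_ : (a 0 i <= t)%R by rewrite le_max lexx.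
have tb : (t <= b 0 i)%R by rewrite ge_max ab ge_min lexx.
apply: (@le_trans _ _ ((\prod_(j < m.+1) (b' 0 j - a 0 j))%:E +
    (\prod_(j < m.+1) (b 0 j - a' 0 j))%:E)).
  apply: leeD; apply: ereal_inf_lbound.
  - exists (a, b') => //=; split=> [j|].
      by rewrite mxE; case: ifPn => // /eqP ->.
    apply/seteqP; split=> x /= => [[xab xc] j|xab'].
      rewrite mxE; case: ifPn => // /eqP ->.
      by have /andP[ax xb] := xab i; rewrite ax le_max le_min xb xc orbT.
    have xi := xab' i; rewrite mxE eqxx in xi; case/andP: xi => ax.
    rewrite le_max leNgt ax/= le_min => /andP[xb xc]; split=> // j.
    by have := xab' j; rewrite mxE; case: ifPn => // /eqP -> _; rewrite ax.
  - exists (a', b) => //=; split=> [j|].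
      by rewrite mxE; case: ifPn => // /eqP ->.
    apply/seteqP; split=> x /= => [[xab /negP]|xab'].
      rewrite -ltNge => cx j; rewrite mxE; case: ifPn => // /eqP ->.
      by have /andP[ax xb] := xab i; rewrite xb gt_max ax gt_min cx orbT.
    have xi := xab' i; rewrite mxE eqxx in xi; case/andP: xi.
    rewrite gt_max gt_min => /andP[ax /orP[|cx]]; first by rewrite ltNge => /negbTE->.
    move=> xb; split=> [j|]; last by apply/negP; rewrite -ltNge.
    by have := xab' j; rewrite mxE; case: ifPn => // /eqP -> _; rewrite ax.
rewrite -EFinD lee_fin (bigD1 i)//= [X in (_ + X <= _)%R](bigD1 i)//=.
rewrite [leRHS](bigD1 i)//= !mxE eqxx.
rewrite (eq_bigr (fun j => b 0 j - a 0 j)%R); last first.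
  by move=> j /negbTE ji; rewrite mxE ji.
rewrite [X in (_ + _ * X <= _)%R](eq_bigr (fun j => b 0 j - a 0 j)%R); last first.
  by move=> j /negbTE ji; rewrite mxE ji.
by rewrite -mulrDl addrC addrA subrK.
Qed.

Lemma lebesgue_outer_halfspace (i : 'I_m.+1) (c : R) :
  (@lebesgue_outer R m).-caratheodory [set x | (x 0 i <= c)%R].
Proof.
apply: le_caratheodory_measurable => A.
rewrite [in leRHS](_ : A = A `&` [set x | (x 0 i <= c)%R] `|`
    A `&` ~` [set x | (x 0 i <= c)%R]); last by rewrite -setIUr setUv setIT.
apply: (@mu_extD_le R 'rV[R]_m.+1 (@box_volume R m) [set x | (x 0 i <= c)%R]
  (~` [set x | (x 0 i <= c)%R])).
- exact: box_volume_ge0.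
- exact: box_volume_cut.
- exact: subIsetr.
- exact: subIsetr.
Qed.

Lemma bounded_coord (A : set 'rV[R]_m.+1) : bounded_set A ->
  exists r : R, (0 <= r)%R /\ forall x, A x -> forall i, (`|x 0%R i| <= r)%R.
Proof.
move=> [M [Mreal normAltM]]; pose r : R := (`|M| + 1)%R.
exists r; split=> [|x Ax i]; first by rewrite addr_ge0.
have Mr : (M < r)%R by rewrite (le_lt_trans (ler_norm M))// ltrDl.
have xr : (`|x| <= r)%R := normAltM r Mr x Ax.
rewrite [leLHS]/Num.norm/= mx_normrE in xr.
by apply: le_trans xr; exact: (le_bigmax _ (fun ij => `|x ij.1 ij.2|)%R (0%R, i)).
Qed.

Lemma lebesgue_outer_bounded (A : set 'rV[R]_m.+1) :
  bounded_set A -> lebesgue_outer A < +oo.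
Proof.
move=> /bounded_coord[r [r0 Ar]].
pose B : set 'rV[R]_m.+1 := [set x | forall i, (- r - 1 < x 0 i <= r)%R].
have AB : A `<=` B.
  move=> x Ax i; have := Ar x Ax i; rewrite ler_norml => /andP[rx ->].
  by rewrite (lt_le_trans _ rx)// ltrBlDr ltrDl.
apply: (@le_lt_trans _ _ (lebesgue_outer B)); first exact: le_mu_ext.
apply: (@le_lt_trans _ _ (box_volume B)).
  apply: ereal_inf_lbound; exists (fun k => if (k == 0)%N then B else set0).
    by split=> // x Bx; exists 0%N.
  rewrite nneseries_recl//=; last by move=> *; exact: box_volume_ge0.
  by rewrite eseries0 ?adde0// => -[//|k _ _] /=; exact: box_volume0.
pose lo : 'rV[R]_m.+1 := const_mx (- r - 1)%R; pose hi : 'rV[R]_m.+1 := const_mx r.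
apply: (@le_lt_trans _ _ (\prod_(i < m.+1) (hi 0 i - lo 0 i))%R%:E); last exact: ltry.
apply: ereal_inf_lbound; exists (lo, hi) => //=; split.
  by move=> i; rewrite !mxE lerBlDr ler_wpDr// (le_trans _ r0)// oppr_le0.
by apply/seteqP; split=> x Bx i; have := Bx i; rewrite !mxE.
Qed.

End box_measure.

Section hausdorff_borel.
Context (R : realType) (n k : nat).
Local Open Scope ereal_scope.

Lemma coord_le_enorm (x : 'rV[R]_n) i : (`|x 0 i| <= enorm x)%R.
Proof.
rewrite -sqrtr_sqr; apply: ler_wsqrtr; rewrite /dot (bigD1 i)//= -expr2 lerDl.
by apply: sumr_ge0 => j _; rewrite -expr2 sqr_ge0.
Qed.

Lemma le_ediam (A B : set 'rV[R]_n) : A `<=` B -> ediam A <= ediam B.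
Proof.
move=> AB; apply: ge_ereal_sup => _ [p [A1 A2] <-]; apply: ereal_sup_ubound; exists p => //.
by split; exact: AB.
Qed.

Lemma le_hausdorff_weight (d d' : R) (A B : set 'rV[R]_n) : (d' <= d)%R ->
  A `<=` B -> hausdorff_weight k d A <= hausdorff_weight k d' B.
Proof.
move=> d'd AB; have [->|A0] := pselect (A = set0).
  by rewrite hausdorff_weight0 hausdorff_weight_ge0.
have B0 : B <> set0 by move=> B0; apply: A0; rewrite -subset0 -B0.
rewrite /hausdorff_weight; case: pselect => //= _; case: pselect => //= _.
case: (boolP (ediam B <= d'%:E)) => [Bd'|_]; last by rewrite leey.
have dB := le_trans Bd' (_ : d'%:E <= d%:E).
rewrite (le_trans (le_ediam AB)) ?dB ?lee_fin//.
have fB : ediam B \is a fin_num.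
  by rewrite ge0_fin_numE ?ediam_ge0// (le_lt_trans Bd')// ltry.
have fA : ediam A \is a fin_num.
  by rewrite ge0_fin_numE ?ediam_ge0// (le_lt_trans (le_ediam AB))// ltey_eq fB.
rewrite ler_wpM2l ?unit_ball_volume_ge0// lerXn2r ?nnegrE ?divr_ge0//.
- by rewrite fine_ge0// ediam_ge0.
- by rewrite fine_ge0// ediam_ge0.
- by rewrite ler_wpM2r ?invr_ge0// fine_le// le_ediam.
Qed.

(** Sets of diameter less than [b - a] cannot meet both half-spaces, so for
small [delta] no set of a covering of [A `|` B] serves both [A] and [B].  Since the
approximate measures increase when [delta] decreases, this is enough for their
suprema. *)
Lemma hausdorff_gap (i : 'I_n) (a b : R) (A B : set 'rV[R]_n) : (a < b)%R ->
  A `<=` [set x | x 0 i <= a]%R -> B `<=` [set x | b <= x 0 i]%R ->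
  hausdorff_outer k A + hausdorff_outer k B <= hausdorff_outer k (A `|` B).
Proof.
move=> ab Aa Bb; set H := hausdorff_outer k (A `|` B).
pose pre d C := mu_ext (@hausdorff_weight R n k d) C.
have pre_le d d' C : (d' <= d)%R -> pre d C <= pre d' C.
  move=> d'd; apply: le_ereal_inf_tmp => _ [F cF <-].
  apply: (@le_trans _ _ (\sum_(j <oo) hausdorff_weight k d (F j))).
    by apply: ereal_inf_lbound; exists F.
  by apply: lee_nneseries => [*|j _]; [exact: hausdorff_weight_ge0|exact: le_hausdorff_weight].
have pre_ge0 d C : 0 <= pre d C by exact: mu_ext_ge0 (@hausdorff_weight_ge0 R n k d) C.
have pre_gap d : (d < b - a)%R -> pre d A + pre d B <= pre d (A `|` B).
  move=> dab; apply: (@mu_extD_le R 'rV[R]_n (@hausdorff_weight R n k d) [set x | x 0 i <= a]%R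
    [set x | b <= x 0 i]%R) => // S; first exact: hausdorff_weight_ge0.
  have [SP|SP] := pselect (S `&` [set x : 'rV[R]_n | x 0 i <= a]%R = set0).
    by rewrite SP hausdorff_weight0 add0e le_hausdorff_weight// => x [].
  have [SQ|SQ] := pselect (S `&` [set x : 'rV[R]_n | b <= x 0 i]%R = set0).
    by rewrite SQ hausdorff_weight0 adde0 le_hausdorff_weight// => x [].
  rewrite [leRHS]/hausdorff_weight; case: pselect => [S0|_] /=.
    by exfalso; apply: SP; rewrite S0 set0I.
  case: ifPn => [Sd|_]; last by rewrite leey.
  exfalso; move/eqP/set0P : SP => [x [Sx /= xa]].
  move/eqP/set0P : SQ => [y [Sy /= yb]].
  have : (enorm (y - x) <= d)%R.
    rewrite -lee_fin; apply: le_trans Sd; apply: ereal_sup_ubound.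
    by exists (y, x).
  apply/negP; rewrite -ltNge; apply: lt_le_trans dab _.
  apply: le_trans (coord_le_enorm _ i); rewrite !mxE.
  by apply: le_trans (ler_norm _); rewrite lerB.
have pre2 d d' : (0 < d)%R -> (0 < d')%R -> pre d A + pre d' B <= H.
  move=> d0 d'0; pose e := Num.min (Num.min d d') ((b - a) / 2)%R.
  have ab0 : (0 < b - a)%R by rewrite subr_gt0.
  have e0 : (0 < e)%R by rewrite !lt_min d0 d'0 divr_gt0.
  apply: (@le_trans _ _ (pre e (A `|` B))); last first.
    by apply: ereal_sup_ubound; exists e.
  apply: le_trans (pre_gap e _); last first.
    by rewrite gt_min ltr_pdivrMr// ltr_pMr// ltr1n orbT.
  by apply: leeD; apply: pre_le; rewrite /e !ge_min lexx ?orbT.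
have [->|Hoo] := eqVneq H +oo; first by rewrite leey.
have Hfin : H \is a fin_num.
  by rewrite ge0_fin_numE ?hausdorff_outer_ge0// ltey.
have [Af Bf] : hausdorff_outer k A \is a fin_num /\ hausdorff_outer k B \is a fin_num.
  split; rewrite ge0_fin_numE ?hausdorff_outer_ge0//;
    apply: (@le_lt_trans _ _ H); rewrite ?ltey//; apply: le_hausdorff_outer;
    [exact: subsetUl|exact: subsetUr].
rewrite -leeBrDr//; apply: ge_ereal_sup => _ [d d0 <-].
rewrite leeBrDr// addeC -leeBrDr; last first.
  rewrite ge0_fin_numE; last exact: pre_ge0.
  apply: (@le_lt_trans _ _ (hausdorff_outer k A)); last by rewrite ltey_eq Af.
  by apply: ereal_sup_ubound; exists d.
apply: ge_ereal_sup => _ [d' d'0 <-].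
rewrite leeBrDr; first by rewrite addeC; exact: pre2.
rewrite ge0_fin_numE; last exact: pre_ge0.
apply: (@le_lt_trans _ _ (hausdorff_outer k A)); last by rewrite ltey_eq Af.
by apply: ereal_sup_ubound; exists d.
Qed.

Lemma hausdorff_outer_halfspace (i : 'I_n) (c : R) :
  (@hausdorff_outer R n k).-caratheodory [set x | (x 0 i <= c)%R].
Proof. exact: (caratheodory_sublevel (@hausdorff_gap i)). Qed.

End hausdorff_borel.

(** * Borel sets and continuous functions *)

Section borel.
Context (R : realType) (n : nat) (mu : {outer_measure set 'rV[R]_n -> \bar R}).
Hypothesis halfspace : forall (i : 'I_n) c,
  mu.-caratheodory [set x : 'rV[R]_n | x 0 i <= c].

Let T := caratheodory_type mu.

Lemma measurable_open (U : set 'rV[R]_n) : open U -> measurable (U : set T).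
Proof.
move=> oU; pose box (q : 'rV[rat]_n * 'rV[rat]_n) : set T :=
  [set x : 'rV[R]_n | forall i, ratr (q.1 0 i) < x 0 i <= ratr (q.2 0 i)].
have mhalf (i : 'I_n) c : measurable ([set x : 'rV[R]_n | x 0 i <= c] : set T).
  exact: halfspace.
have mbox q : measurable (box q).
  rewrite (_ : box q = \bigcap_i
      (~` ([set x : 'rV[R]_n | x 0 i <= ratr (q.1 0 i)] : set T) `&`
       ([set x : 'rV[R]_n | x 0 i <= ratr (q.2 0 i)] : set T))).
    apply: fin_bigcap_measurable => // i _.
    by apply: measurableI => //; exact: measurableC.
  apply/seteqP; split=> x /= bx i; last first.
    by have [/= /negP + ->] := bx i I; rewrite -ltNge andbT.
  by move=> _; have /andP[xl xr] := bx i; split=> //=; apply/negP; rewrite -ltNge.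
rewrite (_ : U = \bigcup_q (if `[< box q `<=` U >] then box q else set0)).
  apply: countable_bigcupT_measurable => [|q]; first exact: countableP.
  by case: ifP => _; [exact: mbox|exact: measurable0].
apply/seteqP; split=> [x Ux|x [q _]]; last by case: ifPn => // /asboolP qU /qU.
have /nbhs_ballP[e /= e0 eU] := open_nbhs_nbhs (conj oU Ux).
have ltl (i : 'I_n) : {q : rat | ratr q \in `]x 0 i - e, x 0 i[}.
  by apply/cid/rat_in_itvoo; rewrite ltrBlDr ltrDl.
have ltr (i : 'I_n) : {q : rat | ratr q \in `]x 0 i, x 0 i + e[}.
  by apply/cid/rat_in_itvoo; rewrite ltrDl.
pose q := (\row_i sval (ltl i), \row_i sval (ltr i)).
have qU : box q `<=` U.
  move=> z qz; apply: eU; split=> // j i; rewrite ord1 /=.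
  have := qz i; rewrite !mxE.
  case: (ltl i) (ltr i) => l /= + [r /=]; rewrite !in_itv/= => /andP[l1 _] /andP[_ r1].
  move=> /andP[lz zr]; suff : `|x 0 i - z 0 i| < e by []; rewrite ltr_distlC; apply/andP; split.
    exact: lt_trans l1 lz.
  exact: le_lt_trans zr r1.
exists q => //; rewrite asboolT// => i /=; rewrite !mxE.
case: (ltl i) (ltr i) => l /= + [r /=]; rewrite !in_itv/= => /andP[_ ->] /andP[/ltW -> _].
by [].
Qed.

Lemma measurable_closed (F : set 'rV[R]_n) : closed F -> measurable (F : set T).
Proof.
move=> cF; rewrite -[F]setCK; apply: (@measurableC _ T).
exact: measurable_open (closed_openC cF).
Qed.

Lemma measurable_boundary (D : set 'rV[R]_n) :
  measurable (closure D `\` interior D : set T).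
Proof.
apply: measurableD; first exact (@measurable_closed (closure D) (@closed_closure _ D)).
exact: measurable_open (open_interior _).
Qed.

(** Asking only that [f] agree near each point, within [D], with some function
continuous at that point covers functions that are smooth on a hypersurface,
where no neighbourhood in the whole space is available. *)
Lemma measurable_fun_locally_continuous (D : set 'rV[R]_n) (f : 'rV[R]_n -> R) :
  measurable (D : set T) ->
  (forall x, D x -> exists F : 'rV[R]_n -> R, [/\ {for x, continuous F} &
     \forall z \near x, D z -> f z = F z]) ->
  measurable_fun (D : set T) f.
Proof.
move=> mD lf; apply: (measurability _ (measurable_realfun.RGenOpens.measurableE R)).
move=> _ [_ [a [b ->] <-]].
pose W : set 'rV[R]_n := interior [set z | D z -> a < f z < b].
rewrite (_ : _ `&` _ = (D : set T) `&` (W : set T)).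
  by apply: measurableI => //; apply: measurable_open; exact: open_interior.
apply/seteqP; split=> x [Dx xW]; split=> //; last first.
  by rewrite /= in_itv/=; exact: (interior_subset xW).
have [F [Fx fF]] := lf x Dx.
move: xW; rewrite /= in_itv/= (nbhs_singleton fF Dx) => Fab.
have oab : nbhs (F x) `]a, b[%classic by apply: open_nbhs_nbhs; split => //=; rewrite in_itv.
have := Fx _ oab; rewrite /W /interior /= => Fnear.
apply: filterS (filterI (Fnear : nbhs (x : 'rV[R]_n) (F @^-1` `]a, b[%classic)) fF) => z.
by rewrite /= in_itv/= => -[Fz fz] Dz; rewrite fz.
Qed.

Lemma measurable_fun_continuous (D : set 'rV[R]_n) (f : 'rV[R]_n -> R) :
  measurable (D : set T) -> continuous f -> measurable_fun (D : set T) f.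
Proof.
move=> mD cf; apply: measurable_fun_locally_continuous => // x Dx.
exists f; split; first exact: cf.
by apply: (@filterE 'rV[R]_n (nbhs (x : 'rV[R]_n))).
Qed.

End borel.

Section interface.
Context (R : realType) (m : nat).
Let E := 'rV[R]_m.+1.
Local Notation Surf := (@hausdorff_outer R m.+1 m).
Implicit Types (M Omega : set E).

Lemma measurable_boundary_surface Omega :
  measurable (boundary Omega : set (caratheodory_type Surf)).
Proof. by apply: measurable_boundary; exact: hausdorff_outer_halfspace. Qed.

(** The interface is what the two open subdomains leave of [Omega]. *)
Lemma measurable_interface M Omega : open Omega -> divides M Omega ->
  measurable (M `&` Omega : set (caratheodory_type Surf)).
Proof.
move=> oO [Dp [Dm [[_ oDp _ _] [_ oDm _ _] _ OM]]].
have -> : M `&` Omega = Omega `\` (Dp `|` Dm) by rewrite -OM setDD setIC.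
have mopen := measurable_open (@hausdorff_outer_halfspace R m.+1 m).
by apply: measurableD; apply: mopen => //; exact: openU.
Qed.

Lemma measurable_on_manifold M Omega (psi : E -> R) :
  measurable (M `&` Omega : set (caratheodory_type Surf)) ->
  smooth_on_manifold M psi ->
  measurable_fun (M `&` Omega : set (caratheodory_type Surf)) psi.
Proof.
move=> mMO spsi; apply: measurable_fun_locally_continuous => //.
  exact: hausdorff_outer_halfspace.
move=> x [Mx _]; have [U [F [oU Ux sF psiF]]] := spsi x Mx.
exists F; split; first by have [] := sF [::] x Ux.
have nU : nbhs x U by exact: open_nbhs_nbhs.
apply: filterS nU => z Uz [Mz _]; apply: psiF.
by rewrite inE; split.
Qed.

End interface.

(** * Square integrable functions *)

Section square_integrable.
Context (R : realType) (n : nat).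
Let E := 'rV[R]_n.+1.
Variables (mu : {outer_measure set E -> \bar R}) (D : set E).
Let T := caratheodory_type mu.
Let nu := cara_measure mu.
Hypothesis mD : measurable (D : set T).
Implicit Types f g : E -> R.

Lemma measurable_sq f : measurable_fun (D : set T) f ->
  measurable_fun (D : set T) ((fun x => (f x ^+ 2)%:E) : E -> \bar R).
Proof. by move=> mf; apply/measurable_EFinP; exact: measurable_funX. Qed.

Lemma measurable_lin (a b : R) f g :
  measurable_fun (D : set T) f -> measurable_fun (D : set T) g ->
  measurable_fun (D : set T) (fun x => a * f x + b * g x).
Proof.
by move=> mf mg; apply: measurable_funD; apply: measurable_funM => //;
  exact: measurable_cst.
Qed.

(** Stated for extended reals, because the smooth approximations in the
definition of a trace are at finite distance only from some index on. *)
Lemma integral_sq_lin_le (a b : R) f g :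
  measurable_fun (D : set T) f -> measurable_fun (D : set T) g ->
  (\int[nu]_(x in D) ((a * f x + b * g x) ^+ 2)%:E <=
   (2 * a ^+ 2)%:E * \int[nu]_(x in D) (f x ^+ 2)%:E +
   (2 * b ^+ 2)%:E * \int[nu]_(x in D) (g x ^+ 2)%:E)%E.
Proof.
move=> mf mg.
have c0 (c : R) : 0 <= 2 * c ^+ 2 by rewrite mulr_ge0// sqr_ge0.
have sq0 h x : D x -> (0%:E <= (h x ^+ 2)%:E :> \bar R)%E by rewrite lee_fin sqr_ge0.
have m2 := measurable_sq.
rewrite -!ge0_integralZl_EFin//; try by [exact: m2|exact: sq0].
rewrite -ge0_integralD//; try by [move=> x Dx; rewrite mule_ge0// ?lee_fin ?c0// sqr_ge0
  |apply: measurable_funeM; exact: m2].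
apply: ge0_le_integral => //.
- by move=> x Dx; rewrite lee_fin sqr_ge0.
- by apply: m2; exact: measurable_lin.
- by apply: emeasurable_funD; apply: measurable_funeM; exact: m2.
- move=> x Dx; rewrite -!EFinM -EFinD lee_fin.
  have := sqr_ge0 (a * f x - b * g x); lra.
Qed.

Lemma L2_lin (a b : R) f g :
  L2 mu D f -> L2 mu D g -> L2 mu D (fun x => a * f x + b * g x).
Proof.
move=> [mf fi] [mg gi]; split; first exact: measurable_lin.
apply: le_lt_trans (integral_sq_lin_le a b mf mg) _.
by apply: lte_add_pinfty; apply: lte_mul_pinfty => //; rewrite lee_fin mulr_ge0// sqr_ge0.
Qed.

Lemma L2_integrable_mul f g : L2 mu D f -> L2 mu D g ->
  nu.-integrable D (fun x => (f x * g x)%:E).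
Proof.
move=> [mf fi] [mg gi].
have isq (h : E -> R) : measurable_fun (D : set T) h -> (\int[nu]_(x in D) (h x ^+ 2)%:E < +oo)%E ->
    nu.-integrable D (fun x => (h x ^+ 2)%:E).
  move=> mh hi; apply/integrableP; split; first exact: measurable_sq.
  by under eq_integral do rewrite gee0_abs ?lee_fin ?sqr_ge0//.
apply: (le_integrable mD _ _ (integrableD mD (isq _ mf fi) (isq _ mg gi))).
  by apply/measurable_EFinP; exact: measurable_funM.
move=> x Dx /=; rewrite lee_fin normrM [leRHS]ger0_norm; last by rewrite addr_ge0 ?sqr_ge0.
rewrite -[f x ^+ 2]real_normK ?num_real// -[g x ^+ 2]real_normK ?num_real//.
have := sqr_ge0 (`|f x| - `|g x|).
have : 0 <= `|f x| * `|g x| by rewrite mulr_ge0.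
lra.
Qed.

Lemma L2_bounded f (C : R) : (nu D < +oo)%E -> measurable_fun (D : set T) f ->
  (forall x, D x -> `|f x| <= C) -> L2 mu D f.
Proof.
move=> Dfin mf fC; split=> //.
apply: (@le_lt_trans _ _ (\int[nu]_(x in D) (C ^+ 2)%:E)%E).
  apply: ge0_le_integral => //.
  - by move=> x _; rewrite lee_fin sqr_ge0.
  - exact: measurable_sq.
  - move=> x Dx; rewrite lee_fin -[f x ^+ 2]real_normK ?num_real//.
    by rewrite lerXn2r ?nnegrE ?fC// (le_trans _ (fC x Dx)).
by rewrite integral_cst// lte_mul_pinfty// lee_fin sqr_ge0.
Qed.

(** The right-hand side may be infinite: in the application [h] contains the
obstacle, which may be unbounded near the boundary. *)
Lemma ae_le_integral f h :
  nu.-integrable D (fun x => (f x)%:E) -> measurable_fun (D : set T) h ->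
  {ae nu, forall x, D x -> f x <= h x} ->
  (\int[nu]_(x in D) (f x)%:E <= \int[nu]_(x in D) (h x)%:E)%E.
Proof.
move=> fi mh fh; have mf := measurable_int _ fi.
have {}mh : measurable_fun (D : set T) ((fun x => (h x)%:E) : E -> \bar R).
  by exact/measurable_EFinP.
rewrite integralE [leRHS]integralE; apply: leeB.
  apply: ae_ge0_le_integral => //; [exact: measurable_funepos..|].
  apply: (filterS (F := almost_everywhere nu) _ fh) => x {}fh Dx; rewrite !funeposE.
  by rewrite ge_max !le_max lexx orbT andbT lee_fin fh.
apply: ae_ge0_le_integral => //; [exact: measurable_funeneg..|].
apply: (filterS (F := almost_everywhere nu) _ fh) => x {}fh Dx; rewrite !funenegE.
by rewrite ge_max !le_max lexx orbT andbT leeN2 lee_fin fh.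
Qed.

End square_integrable.

(** * Square integrable vector fields *)

Section vector_fields.
Context (R : realType) (m : nat).
Let E := 'rV[R]_m.+1.
Variable D : set E.
Local Notation Leb := (@lebesgue_outer R m).
Let T := caratheodory_type Leb.
Hypothesis mD : measurable (D : set T).
Implicit Types (G H K : E -> E) (a b : R).

Definition measurable_field G :=
  forall i, measurable_fun (D : set T) (fun x => G x 0 i).

Definition inner G H : R := \int[leb R m]_(x in D) dot (G x) (H x).

Lemma lin_coord a b G H i : (fun x => (a *: G x + b *: H x) 0 i) =
  (fun x => a * G x 0 i + b * H x 0 i).
Proof. by apply/funext => x; rewrite !mxE. Qed.

Lemma dot_linl a b (x y z : E) :
  dot (a *: x + b *: y) z = a * dot x z + b * dot y z.
Proof.
rewrite /dot !mulr_sumr -big_split/=; apply: eq_bigr => i _.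
by rewrite !mxE; ring.
Qed.

Lemma enorm_sqr (x : E) : enorm x ^+ 2 = \sum_i x 0 i ^+ 2.
Proof.
rewrite sqr_sqrtr; last by apply: sumr_ge0 => i _; rewrite -expr2 sqr_ge0.
by apply: eq_bigr => i _; rewrite expr2.
Qed.

Lemma sqnorm_sum G : measurable_field G ->
  (sqnorm D G = \sum_i \int[leb R m]_(x in D) (G x 0 i ^+ 2)%:E)%E.
Proof.
move=> mG; rewrite -ge0_integral_sum//=.
- by apply: eq_integral => x _; rewrite enorm_sqr sumEFin.
- by move=> i; exact: measurable_sq.
- by move=> i x _; rewrite lee_fin sqr_ge0.
Qed.

Lemma sqnorm_lin_le a b G H : measurable_field G -> measurable_field H ->
  (sqnorm D (fun x => a *: G x + b *: H x)%R <=
   (2 * a ^+ 2)%:E * sqnorm D G + (2 * b ^+ 2)%:E * sqnorm D H)%E.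
Proof.
move=> mG mH.
have mGH : measurable_field (fun x => a *: G x + b *: H x).
  move=> i; rewrite [X in measurable_fun _ X]lin_coord.
  exact (measurable_lin a b (mG i) (mH i)).
rewrite (sqnorm_sum mGH) (sqnorm_sum mG) (sqnorm_sum mH).
rewrite !ge0_sume_distrr; try by [move=> i _; apply: integral_ge0 => x _; rewrite lee_fin sqr_ge0].
rewrite -big_split/=; apply: lee_sum => i _.
apply: le_trans (integral_sq_lin_le mD a b (mG i) (mH i)).
rewrite le_eqVlt; apply/orP; left; apply/eqP.
by congr (integral _ _ _); apply/funext => x; rewrite !mxE.
Qed.

Lemma L2vec_lin a b G H : L2vec D G -> L2vec D H ->
  L2vec D (fun x => a *: G x + b *: H x).
Proof. by move=> LG LH i; rewrite [X in L2 _ _ X]lin_coord; exact: L2_lin. Qed.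

Lemma integrable_dot G H : L2vec D G -> L2vec D H ->
  (leb R m).-integrable D (EFin \o (fun x => dot (G x) (H x))).
Proof.
move=> LG LH; rewrite (_ : _ \o _ = fun x => (\sum_i (G x 0 i * H x 0 i)%:E)%E).
  by apply: integrable_sum => // i _; exact: L2_integrable_mul.
by apply/funext => x /=; rewrite /dot sumEFin.
Qed.

Lemma integral_dot G H : L2vec D G -> L2vec D H ->
  (\int[leb R m]_(x in D) (dot (G x) (H x))%:E = (inner G H)%:E)%E.
Proof. by move=> LG LH; rewrite fineK// integrable_fin_num//; exact: integrable_dot. Qed.

Lemma sqnorm_inner G : L2vec D G -> sqnorm D G = (inner G G)%:E.
Proof.
move=> LG; rewrite -integral_dot//; apply: eq_integral => x _.
by rewrite enorm_sqr; congr EFin; apply: eq_bigr => i _; rewrite expr2.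
Qed.

Lemma inner_ge0 G : 0 <= inner G G.
Proof.
by apply: Rintegral_ge0 => x _; apply: sumr_ge0 => i _; rewrite -expr2 sqr_ge0.
Qed.

Lemma innerC G H : inner G H = inner H G.
Proof. by apply: eq_Rintegral => x _; apply: eq_bigr => i _; rewrite mulrC. Qed.

Lemma inner_linl a b G H K : L2vec D G -> L2vec D H -> L2vec D K ->
  inner (fun x => a *: G x + b *: H x) K = a * inner G K + b * inner H K.
Proof.
move=> LG LH LK.
rewrite -!RintegralZl//; try exact: integrable_dot.
rewrite -RintegralD//; first by apply: eq_Rintegral => x _; rewrite dot_linl.
- by apply: (integrableZl mD a (integrable_dot LG LK)).
- by apply: (integrableZl mD b (integrable_dot LH LK)).
Qed.

Lemma inner_linr a b G H K : L2vec D G -> L2vec D H -> L2vec D K ->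
  inner K (fun x => a *: G x + b *: H x) = a * inner K G + b * inner K H.
Proof. by move=> LG LH LK; rewrite innerC inner_linl// innerC [inner H K]innerC. Qed.

Lemma sqnorm_lin a b G H : L2vec D G -> L2vec D H ->
  sqnorm D (fun x => a *: G x + b *: H x) =
  (a ^+ 2 * inner G G + 2 * a * b * inner G H + b ^+ 2 * inner H H)%:E.
Proof.
move=> LG LH; have LGH := L2vec_lin a b LG LH.
rewrite sqnorm_inner// inner_linl// !inner_linr//; congr EFin.
by rewrite (innerC H G); ring.
Qed.

End vector_fields.

(** * Linear combinations of smooth functions *)

Section smooth_lin.
Context (R : realType) (n : nat).
Implicit Types (f g : 'rV[R]_n -> R) (a b : R).

Lemma derivable_lin (V W : normedModType R) a b (f g : V -> W) x v :
  derivable f x v -> derivable g x v ->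
  derivable (fun y => a *: f y + b *: g y) x v /\
  'D_v (fun y => a *: f y + b *: g y) x = a *: 'D_v f x + b *: 'D_v g x.
Proof.
move=> df dg; have adf := @derivableZ _ _ _ f a x v df.
have bdg := @derivableZ _ _ _ g b x v dg.
split; first exact: derivableD adf bdg.
by rewrite [LHS](deriveD adf bdg) (deriveZ _ df) (deriveZ _ dg).
Qed.

Lemma iter_partial_lin a b f g (s : seq 'I_n) :
  smooth_on setT f -> smooth_on setT g ->
  foldr partial (fun x => a * f x + b * g x) s =
  (fun x => a * foldr partial f s x + b * foldr partial g s x).
Proof.
move=> sf sg; elim: s => //= i s ->; apply/funext => x.
have [_ df] := sf s x I; have [_ dg] := sg s x I.
exact: (@derivable_lin _ R^o a b _ _ x _ (df i) (dg i)).2.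
Qed.

Lemma smooth_lin a b f g : smooth_on setT f -> smooth_on setT g ->
  smooth_on setT (fun x => a * f x + b * g x).
Proof.
move=> sf sg s x _; rewrite iter_partial_lin//.
have [cf df] := sf s x I; have [cg dg] := sg s x I; split.
  by apply: continuousD; apply: continuousM => //; exact: cst_continuous.
by move=> i; exact: (@derivable_lin _ R^o a b _ _ x _ (df i) (dg i)).1.
Qed.

Lemma gradient_lin a b f g x : smooth_on setT f -> smooth_on setT g ->
  gradient (fun x => a * f x + b * g x) x = a *: gradient f x + b *: gradient g x.
Proof.
move=> sf sg; apply/rowP => i; rewrite !mxE.
by have := iter_partial_lin a b [:: i] sf sg => /= ->.
Qed.

Lemma continuous_smooth f : smooth_on setT f -> continuous f.
Proof. by move=> sf x; have [] := sf [::] x I. Qed.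

Lemma continuous_partial f i : smooth_on setT f -> continuous (partial i f).
Proof. by move=> sf x; have [] := sf [:: i] x I. Qed.

End smooth_lin.

(** * Linear combinations of Sobolev functions and of traces *)

Section sobolev_lin.
Context (R : realType) (m : nat) (Omega : set 'rV[R]_m.+1).
Hypotheses (oOmega : open Omega) (bOmega : bounded_set Omega).
Let E := 'rV[R]_m.+1.
Local Notation Leb := (@lebesgue_outer R m).
Local Notation Surf := (@hausdorff_outer R m.+1 m).
Implicit Types (u v w : H1 Omega) (a b : R).

Lemma measurable_domain : measurable (Omega : set (caratheodory_type Leb)).
Proof. by apply: measurable_open => //; exact: lebesgue_outer_halfspace. Qed.

(** A bounded set lies in a compact cube, on which the function is bounded;
this makes test functions and their derivatives square integrable, so that the
two sides of the integration by parts formula are additive. *)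
Lemma L2_continuous (f : E -> R) : continuous f -> L2 Leb Omega f.
Proof.
move=> cf; have mO := measurable_domain.
have [r [r0 Or]] := bounded_coord bOmega.
pose K := [set x : E | forall i, `[(- r), r]%classic (x 0 i)].
have cK : compact K.
  apply: (rV_compact (A := fun=> `[(- r), r]%classic)) => i; exact: segment_compact.
have [M [_ fM]] : bounded_set (f @` K).
  apply: compact_bounded; apply: continuous_compact => //.
  exact: continuous_subspaceT.
apply: (@L2_bounded _ _ _ _ mO _ (`|M| + 1)).
- exact: lebesgue_outer_bounded.
- apply: measurable_fun_continuous => //; exact: lebesgue_outer_halfspace.
- move=> x Ox; apply: (fM (`|M| + 1)).
    by rewrite (le_lt_trans (ler_norm M))// ltrDl.
  by exists x => // i; rewrite /= in_itv/= -ler_norml; exact: Or.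
Qed.

(** Linear structure of H^1.  An existence statement is enough, because its
users only need the values and the gradient of the combination. *)
Lemma H1_lin a b u v : exists w : H1 Omega,
  (w = (fun x => a * u x + b * v x) :> (E -> R)) /\
  grad w = (fun x => a *: grad u x + b *: grad v x).
Proof.
have mO := measurable_domain.
have L2w : L2 Leb Omega (fun x => a * u x + b * v x).
  exact (L2_lin mO a b (@H1_L2 _ _ _ u) (@H1_L2 _ _ _ v)).
have L2g : L2vec Omega (fun x => a *: grad u x + b *: grad v x).
  exact (L2vec_lin mO a b (@grad_L2 _ _ _ u) (@grad_L2 _ _ _ v)).
have wg : weak_gradient Omega (fun x => a * u x + b * v x)
    (fun x => a *: grad u x + b *: grad v x).
  move=> zeta i tz; have [sz _ _] := tz.
  have Lz := L2_continuous (continuous_smooth sz).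
  have Ldz := L2_continuous (continuous_partial (i := i) sz).
  have wu := @H1_weak_gradient _ _ _ u zeta i tz.
  have wv := @H1_weak_gradient _ _ _ v zeta i tz.
  have intfun w := L2_integrable_mul mO (H1_L2 w) Ldz.
  have intgrad w := L2_integrable_mul mO (grad_L2 w i) Lz.
  transitivity (\int[leb R m]_(x in Omega)
     (a%:E * (u x * partial i zeta x)%:E + b%:E * (v x * partial i zeta x)%:E))%E.
    congr (integral _ _ _); apply/funext => x.
    by rewrite -!EFinM -EFinD; congr EFin; ring.
  rewrite integralD//; [|exact: integrableZl..].
  rewrite !integralZl// wu wv !muleN -oppeD; last first.
    by apply: fin_num_adde_defl; rewrite fin_numM// integrable_fin_num.
  congr (- _)%E; rewrite -!integralZl//; [|exact: intgrad..].
  rewrite -integralD//; [|by apply: integrableZl => //; exact: intgrad..].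
  congr (integral _ _ _); apply/funext => x.
  by rewrite -!EFinM -EFinD !mxE; congr EFin; ring.
by exists (MkH1 L2w L2g wg).
Qed.

Lemma cvge0_lin_squeeze (c d : R) (f g h : nat -> \bar R) : 0 <= c -> 0 <= d ->
  (forall k, (0 <= h k <= c%:E * f k + d%:E * g k)%E) ->
  (f k @[k --> \oo] --> 0)%E -> (g k @[k --> \oo] --> 0)%E ->
  (h k @[k --> \oo] --> 0)%E.
Proof.
move=> c0 d0 hfg f0 g0.
apply: (@squeeze_cvge _ _ _ _ (cst 0%E) _ (fun k => c%:E * f k + d%:E * g k)%E).
- exact: nearW.
- exact: cvg_cst.
- rewrite -[X in _ --> X](_ : c%:E * 0 + d%:E * 0 = 0)%E; last by rewrite !mule0 adde0.
  by apply: cvgeD; [rewrite !mule0|exact: cvgeZl|exact: cvgeZl].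
Qed.

(** The combination of the approximating sequences works, since the square of
a combination is at most a combination of the squares. *)
Lemma is_trace_lin (S : set E) a b u v w (g h : E -> R) :
  measurable (S : set (caratheodory_type Surf)) ->
  w = (fun x => a * u x + b * v x) :> (E -> R) ->
  grad w = (fun x => a *: grad u x + b *: grad v x) ->
  is_trace S u g -> is_trace S v h ->
  is_trace S w (fun x => a * g x + b * h x).
Proof.
move=> mS wE gwE [Lg [f_ [sf f0 df0 fg0]]] [Lh [k_ [sk k0 dk0 kh0]]].
have mO := measurable_domain.
have mcont (f : E -> R) : continuous f ->
    measurable_fun (Omega : set (caratheodory_type Leb)) f.
  by apply: measurable_fun_continuous => //; exact: lebesgue_outer_halfspace.
have mcontS (f : E -> R) : continuous f ->
    measurable_fun (S : set (caratheodory_type Surf)) f.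
  by apply: measurable_fun_continuous => //; exact: hausdorff_outer_halfspace.
have sq0 (c : R) : 0 <= 2 * c ^+ 2 by rewrite mulr_ge0// sqr_ge0.
split; first exact: L2_lin.
exists (fun j x => a * f_ j x + b * k_ j x); split.
- by move=> j; exact: smooth_lin.
- apply: (cvge0_lin_squeeze (sq0 a) (sq0 b) _ f0 k0) => j; apply/andP; split.
    by apply: integral_ge0 => x _; rewrite lee_fin sqr_ge0.
  apply: le_trans (integral_sq_lin_le mO a b (f := fun x => f_ j x - u x)
    (g := fun x => k_ j x - v x) _ _).
  + rewrite le_eqVlt; apply/orP; left; apply/eqP.
    by congr (integral _ _ _); apply/funext => x; rewrite wE; congr (_ ^+ 2)%:E; ring.
  + by apply: measurable_funB; [apply: mcont; exact: continuous_smooth|exact: (H1_L2 u).1].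
  + by apply: measurable_funB; [apply: mcont; exact: continuous_smooth|exact: (H1_L2 v).1].
- have mgrad (f : E -> R) (z : H1 Omega) : smooth_on setT f ->
      measurable_field Omega (fun x => gradient f x - grad z x).
    move=> sm i; rewrite (_ : (fun x => _) = (fun x => partial i f x - grad z x 0 i)).
      have [mz _] := @grad_L2 _ _ _ z i.
      by apply: measurable_funB _ mz; apply: mcont; exact: continuous_partial.
    by apply/funext => x; rewrite !mxE.
  apply: (cvge0_lin_squeeze (sq0 a) (sq0 b) _ df0 dk0) => j; apply/andP; split.
    by apply: integral_ge0 => x _; rewrite lee_fin sqr_ge0.
  apply: le_trans (sqnorm_lin_le mO a b (mgrad _ u (sf j)) (mgrad _ v (sk j))).
  rewrite le_eqVlt; apply/orP; left; apply/eqP.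
  congr (integral _ _ _); apply/funext => x; rewrite gwE gradient_lin//.
  by congr (enorm _ ^+ 2)%:E; rewrite !scalerBr opprD addrACA.
- apply: (cvge0_lin_squeeze (sq0 a) (sq0 b) _ fg0 kh0) => j; apply/andP; split.
    by apply: integral_ge0 => x _; rewrite lee_fin sqr_ge0.
  apply: le_trans (integral_sq_lin_le mS a b (f := fun x => f_ j x - g x)
    (g := fun x => k_ j x - h x) _ _).
  + rewrite le_eqVlt; apply/orP; left; apply/eqP.
    by congr (integral _ _ _); apply/funext => x; congr (_ ^+ 2)%:E; ring.
  + by apply: measurable_funB; [apply: mcontS; exact: continuous_smooth|exact: Lg.1].
  + by apply: measurable_funB; [apply: mcontS; exact: continuous_smooth|exact: Lh.1].
Qed.

End sobolev_lin.

(** * The obstacle problem *)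

(** Divide by [t] and let it tend to zero; the witness [t] is small enough for
[t * q <= - p] when [p < 0]. *)
Lemma quadratic_first_variation (R : realType) (p q : R) :
  (forall t, 0 < t <= 1 -> 0 <= 2 * t * p + t ^+ 2 * q) -> 0 <= p.
Proof.
move=> pq; rewrite leNgt; apply/negP => p0.
pose t := Num.min 1 (- p / (`|q| + 1)).
have q0 : 0 < `|q| + 1 by rewrite ltr_pwDr.
have t0 : 0 < t by rewrite lt_min ltr01 divr_gt0// oppr_gt0.
have t1 : t <= 1 by rewrite ge_min lexx.
have tq : t * q <= - p.
  apply: (@le_trans _ _ (t * (`|q| + 1))).
    by rewrite ler_wpM2l ?(ltW t0)// (le_trans (ler_norm q))// lerDl.
  by rewrite -ler_pdivlMr// ge_min lexx orbT.
have := pq t; rewrite t0 t1 => /(_ isT).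
rewrite (_ : 2 * t * p + t ^+ 2 * q = t * (2 * p + t * q)); last by ring.
by rewrite pmulr_rge0// => ?; lra.
Qed.

Section obstacle.
Context (R : realType) (m : nat) (Omega M : set 'rV[R]_m.+1)
  (psi phi : 'rV[R]_m.+1 -> R).
Hypotheses (oOmega : open Omega) (bOmega : bounded_set Omega)
  (dM : divides M Omega).
Implicit Types u v w : H1 Omega.

Let mO := measurable_domain oOmega.
Let mMO := measurable_interface oOmega dM.

Lemma admissible_segment u v (t : R) : 0 <= t <= 1 ->
  admissible M psi phi u -> admissible M psi phi v ->
  exists2 w : H1 Omega, admissible M psi phi w &
    grad w = (fun x => (1 - t) *: grad u x + t *: grad v x).
Proof.
move=> /andP[t0 t1] [[gu tu psiu] phiu] [[gv tv psiv] phiv].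
have [w [wE gwE]] := H1_lin oOmega bOmega (1 - t) t u v.
exists w; last exact: gwE.
split.
  exists (fun x => (1 - t) * gu x + t * gv x).
    exact: (is_trace_lin oOmega mMO wE gwE tu tv).
  pose ae := almost_everywhere (hausdorff R m.+1 m).
  have aeF : Filter ae by apply: ae_filter_ringOfSetsType.
  apply: (filterS (F := ae) _ (filterI (F := ae) psiu psiv)) => x [pu pv] Mx.
  have -> : psi x = (1 - t) * psi x + t * psi x by ring.
  by rewrite lerD// ler_wpM2l ?subr_ge0 ?pu ?pv.
have mB := @measurable_boundary_surface R m Omega.
rewrite (_ : phi = fun x => (1 - t) * phi x + t * phi x); last first.
  by apply/funext => x; ring.
exact: (is_trace_lin oOmega mB wE gwE phiu phiv).
Qed.

(** Compare the energy of [u] with that of [u + t (v - u)] for small [t]. *)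
Lemma variational_inequality u v :
  minimizer (admissible M psi phi) u -> admissible M psi phi v ->
  0 <= inner Omega (grad u) (fun x => 1 *: grad v x + (-1) *: grad u x).
Proof.
move=> [Ku umin] Kv.
have Lu := @grad_L2 _ _ _ u; have Lv := @grad_L2 _ _ _ v.
set d := fun x => _.
have Ld : L2vec Omega d by exact (L2vec_lin mO 1 (-1) Lv Lu).
apply: (@quadratic_first_variation _ _ (inner Omega d d)) => t /andP[t0 t1].
have [|w Kw gw] := @admissible_segment u v t _ Ku Kv; first by rewrite ltW.
have := umin w Kw; rewrite /J lee_pmul2l// gw.
have -> : (fun x => (1 - t) *: grad u x + t *: grad v x) =
    (fun x => 1 *: grad u x + t *: d x).
  apply/funext => x; apply/rowP => i; rewrite !mxE; ring.
rewrite (sqnorm_lin mO 1 t Lu Ld) (sqnorm_inner mO Lu) lee_fin.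
lra.
Qed.

End obstacle.

Unset Implicit Arguments.

Theorem theorem2p1 (R : realType) (m : nat) (Omega M : set 'rV[R]_m.+1)
    (psi phi : 'rV[R]_m.+1 -> R) (u : H1 Omega) :
  lipschitz_domain Omega -> bounded_set Omega ->
  smooth_hypersurface M -> divides M Omega ->
  smooth_on_manifold M psi ->
  Hhalf Omega phi -> (forall x, (M `&` boundary Omega) x -> psi x <= phi x) ->
  minimizer (admissible M psi phi) u ->
  forall (v : H1 Omega) (lam vM : 'rV[R]_m.+1 -> R)
         (y : 'rV[R]_m.+1 -> 'rV[R]_m.+1),
    admissible M psi phi v -> Lambda Omega M lam -> Qstar Omega M lam y ->
    is_trace (M `&` Omega) v vM ->
    (sqnorm Omega (fun x => (grad v x - grad u x)%R) <=
     sqnorm Omega (fun x => (grad v x - y x)%R) +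
     2%:E * \int[hausdorff R m.+1 m]_(x in M `&` Omega)
              (lam x * (vM x - psi x))%:E)%E.
Proof.
move=> [_ oO _ _] bO _ dM spsi _ _ umin v lam vM y Kv [Llam lam0] [Ly Qy] tv.
have mO := measurable_domain oO.
have mMO := measurable_interface oO dM.
have mB := @measurable_boundary_surface R m Omega.
have Lu := @grad_L2 _ _ _ u; have Lv := @grad_L2 _ _ _ v.
have [[[uM tu psiu] phiu] _] := umin; have [_ phiv] := Kv.
have [w [wE gwE]] := H1_lin oO bO 1 (-1) v u.
have w0 : H10 w.
  have := is_trace_lin oO mB wE gwE phiv phiu.
  rewrite (_ : (fun x => _) = cst 0)//.
  by apply/funext => x /=; ring.
have wM := is_trace_lin oO mMO wE gwE tv tu.
set d := fun x => 1 *: grad v x + (-1) *: grad u x in gwE.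
have Ld : L2vec Omega d by exact (L2vec_lin mO 1 (-1) Lv Lu).
have work : (\int[hausdorff R m.+1 m]_(x in M `&` Omega)
    (lam x * (1 * vM x + (-1) * uM x))%:E = (inner Omega y d)%:E)%E.
  by rewrite -(Qy w _ w0 wM) gwE (integral_dot mO Ly Ld).
have gap : ((inner Omega y d)%:E <= \int[hausdorff R m.+1 m]_(x in M `&` Omega)
    (lam x * (vM x - psi x))%:E)%E.
  have mpsi := measurable_on_manifold mMO spsi.
  have [Lw _] := wM; have [mlam _] := Llam; have [[mvM _] _] := tv.
  rewrite -work.
  apply: (ae_le_integral mMO (f := fun x => lam x * (1 * vM x + (-1) * uM x))
    (h := fun x => lam x * (vM x - psi x))).
  - exact: (L2_integrable_mul mMO Llam Lw).
  - exact (measurable_funM mlam (measurable_funB mvM mpsi)).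
  - pose ae := almost_everywhere (hausdorff R m.+1 m).
    have aeF : Filter ae by apply: ae_filter_ringOfSetsType.
    apply: (filterS (F := ae) _ (filterI (F := ae) lam0 psiu)) => x [l0 pu] Mx.
    by rewrite ler_wpM2l ?l0// mul1r mulN1r lerB// pu.
have Luy := L2vec_lin mO 1 (-1) Lu Ly.
have dE : (fun x => grad v x - grad u x) = d.
  by apply/funext => x; rewrite /d scale1r scaleN1r.
have vyE : (fun x => grad v x - y x) =
    (fun x => 1 *: d x + 1 *: (1 *: grad u x + (-1) *: y x)).
  by apply/funext => x; rewrite /d !scale1r !scaleN1r addrA subrK.
have du := variational_inequality oO bO dM umin Kv.
rewrite -/d in du.
rewrite dE vyE (sqnorm_inner mO Ld) (sqnorm_lin mO 1 1 Ld Luy).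
apply: (@le_trans _ _ ((1 ^+ 2 * inner Omega d d + 2 * 1 * 1 *
    inner Omega d (fun x => 1 *: grad u x + (-1) *: y x) + 1 ^+ 2 *
    inner Omega (fun x => 1 *: grad u x + (-1) *: y x)
      (fun x => 1 *: grad u x + (-1) *: y x))%:E + 2%:E * (inner Omega y d)%:E)%E).
  rewrite -EFinM -EFinD lee_fin (inner_linr mO 1 (-1) Lu Ly Ld).
  rewrite (innerC Omega d (grad u)) (innerC Omega d y).
  have := inner_ge0 Omega (fun x => 1 *: grad u x + (-1) *: y x).
  by move: du; lra.
by rewrite leeD2l// lee_pmul2l.
Qed.
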